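(* Let $p=2$, let $a,b,c\in\mathbb{Q}_2$ with $a\neq c$ and $c^2-ac+b\neq 0$, let $f(x)=\frac{x^2+ax+b}{x+c}$ for $x\in\mathbb{Q}_2$, $x\neq -c$, let $x_0=\frac{b}{c-a}$ be its unique fixed point, and put $\alpha=|x_0+a|_2$, $\beta=|x_0+c|_2$. Let $r\in I$ be a value of the $2$-adic norm (so that $f$ maps the sphere $S_r(x_0)$ to itself). Then the dynamical system $(S_r(x_0),f,\mu)$ is ergodic if and only if $\alpha\neq\beta$ and $r=2\max\{\alpha,\beta\}$.
   Context: Here $|\cdot|_2$ is the $2$-adic norm on $\mathbb{Q}_2$ normalized by $|2|_2=1/2$. For $s\in\mathbb{Q}_2$ and $\rho>0$, $U_\rho(s)=\{x\in\mathbb{Q}_2:|x-s|_2\le\rho\}$ and $S_\rho(s)=\{x\in\mathbb{Q}_2:|x-s|_2=\rho\}$. A value of the $2$-adic norm means a number of the form $2^k$, $k\in\mathbb{Z}$. The set $I$ of positive reals is $I=\{r: r>\max\{\alpha,\beta\}\}$ if $\alpha\neq\beta$, and $I=\{r: r\neq\beta\}$ if $\alpha=\beta$. For $r\in I$, one has $-c\notin S_r(x_0)$ and $f(S_r(x_0))\subset S_r(x_0)$. $\mu$ is the normalized Haar measure on the Borel $\sigma$-algebra $\mathcal{B}$ of $S_r(x_0)$: the restriction to $S_r(x_0)$ of the Haar measure $\bar\mu$ on $\mathbb{Q}_2$ with $\bar\mu(U_\rho(s))=\rho$ for every $\rho\in 2^{\mathbb{Z}}$, divided by $\bar\mu(S_r(x_0))=r/2$.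 The map $f$ preserves $\mu$. The system $(S_r(x_0),f,\mu)$ is called ergodic if every invariant set $V\in\mathcal{B}$ (i.e. with $f(V)\subset V$) satisfies $\mu(V)=0$ or $\mu(V)=1$. *)

(* Defs.v *)
From HB Require Import structures.
From mathcomp Require Import all_boot all_order all_algebra.
From mathcomp Require Import generic_quotient.
From mathcomp Require Import all_classical all_reals all_analysis.

Set Implicit Arguments.
Unset Strict Implicit.
Unset Printing Implicit Defensive.

Import Order.TTheory GRing.Theory Num.Theory.

Local Open Scope classical_set_scope.
Local Open Scope ring_scope.

(* Q2 is built as the fraction field of Z2, the inverse limit of the rings
   Z / 2^n; it is then given the 2-adic norm, whose values are taken in an
   arbitrary realFieldType. *)

(* res n is the representative in [0, 2^n) of the class modulo 2^n; the bound
   follows from the compatibility condition. *)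
Definition compatible : pred (nat -> nat) :=
  fun u => `[< forall n, u n.+1 %% 2 ^ n = u n >]%N.

Record Z2 := MkZ2 { res : nat -> nat; resP : compatible res }.

HB.instance Definition _ := [isSub for res].
HB.instance Definition _ := [Choice of Z2 by <:].

Lemma resS (x : Z2) n : (res x n.+1 %% 2 ^ n = res x n)%N.
Proof. by have /asboolP := resP x. Qed.

Lemma res_lt (x : Z2) n : (res x n < 2 ^ n)%N.
Proof. by rewrite -resS ltn_pmod // expn_gt0. Qed.

Lemma res_mod (x : Z2) m n : (m <= n)%N -> (res x n %% 2 ^ m = res x m)%N.
Proof.
elim: n => [|n IHn]; first by rewrite leqn0 => /eqP->; rewrite modn_small ?res_lt.
rewrite leq_eqVlt => /orP[/eqP->|lemn]; first by rewrite modn_small ?res_lt.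
by rewrite -IHn // -(resS x n) modn_dvdm // dvdn_exp2l.
Qed.

Lemma res_small (x : Z2) n : (res x n %% 2 ^ n = res x n)%N.
Proof. exact: res_mod. Qed.

Lemma Z2_eqP (x y : Z2) : res x =1 res y -> x = y.
Proof. by move=> exy; apply: val_inj; apply: funext. Qed.

Lemma compatible_mod (u : nat -> nat) :
  (forall n, u n.+1 = u n %[mod 2 ^ n])%N ->
  compatible (fun n => u n %% 2 ^ n)%N.
Proof.
by move=> uP; apply/asboolP => n; rewrite modn_dvdm ?dvdn_exp2l // uP.
Qed.

Lemma Z2_const_subproof (k n : nat) : (k = k %[mod 2 ^ n])%N.
Proof. by []. Qed.

Definition Z2_const (k : nat) : Z2 := MkZ2 (compatible_mod (Z2_const_subproof k)).

Lemma Z2_add_subproof (x y : Z2) n :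
  (res x n.+1 + res y n.+1 = res x n + res y n %[mod 2 ^ n])%N.
Proof. by rewrite -modnDm !resS. Qed.

Definition Z2_add (x y : Z2) : Z2 := MkZ2 (compatible_mod (Z2_add_subproof x y)).

Lemma Z2_mul_subproof (x y : Z2) n :
  (res x n.+1 * res y n.+1 = res x n * res y n %[mod 2 ^ n])%N.
Proof. by rewrite -modnMm !resS. Qed.

Definition Z2_mul (x y : Z2) : Z2 := MkZ2 (compatible_mod (Z2_mul_subproof x y)).

Lemma Z2_opp_subproof (x : Z2) n :
  (2 ^ n.+1 - res x n.+1 = 2 ^ n - res x n %[mod 2 ^ n])%N.
Proof.
apply/eqP; rewrite -(eqn_modDr (res x n)) subnK ?(ltnW (res_lt _ _)) //.
rewrite -(resS x n) -modnDmr modn_mod modnDmr.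
by rewrite subnK ?(ltnW (res_lt _ _)) // expnS modnMl modnn.
Qed.

Definition Z2_opp (x : Z2) : Z2 := MkZ2 (compatible_mod (Z2_opp_subproof x)).

Lemma Z2_addA : associative Z2_add.
Proof. by move=> x y z; apply: Z2_eqP => n /=; rewrite modnDml modnDmr addnA. Qed.

Lemma Z2_addC : commutative Z2_add.
Proof. by move=> x y; apply: Z2_eqP => n /=; rewrite addnC. Qed.

Lemma Z2_add0 : left_id (Z2_const 0) Z2_add.
Proof. by move=> x; apply: Z2_eqP => n /=; rewrite mod0n add0n res_small. Qed.

Lemma Z2_addN : left_inverse (Z2_const 0) Z2_opp Z2_add.
Proof.
move=> x; apply: Z2_eqP => n /=.
by rewrite modnDml subnK ?modnn ?mod0n // ltnW // res_lt.
Qed.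

HB.instance Definition _ :=
  GRing.isZmodule.Build Z2 Z2_addA Z2_addC Z2_add0 Z2_addN.

Lemma Z2_mulA : associative Z2_mul.
Proof. by move=> x y z; apply: Z2_eqP => n /=; rewrite modnMml modnMmr mulnA. Qed.

Lemma Z2_mulC : commutative Z2_mul.
Proof. by move=> x y; apply: Z2_eqP => n /=; rewrite mulnC. Qed.

Lemma Z2_mul1 : left_id (Z2_const 1) Z2_mul.
Proof. by move=> x; apply: Z2_eqP => n /=; rewrite modnMml mul1n res_small. Qed.

Lemma Z2_mulD : left_distributive Z2_mul Z2_add.
Proof.
by move=> x y z; apply: Z2_eqP => n /=; rewrite modnMml modnDm mulnDl.
Qed.

Lemma Z2_1neq0 : Z2_const 1 != 0.
Proof. by apply/eqP => /(congr1 (fun x : Z2 => res x 1)). Qed.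

HB.instance Definition _ :=
  GRing.Zmodule_isComNzRing.Build Z2 Z2_mulA Z2_mulC Z2_mul1 Z2_mulD Z2_1neq0.

Definition Z2_unit : {pred Z2} := fun x => `[< exists y, y * x = 1 >].

Definition Z2_inv (x : Z2) : Z2 :=
  if pselect (exists y, y * x = 1) is left e then projT1 (cid e) else x.

Lemma Z2_mulV : {in Z2_unit, left_inverse 1 Z2_inv *%R}.
Proof.
move=> x /asboolP ex; rewrite /Z2_inv; case: pselect => // e.
by case: (cid e).
Qed.

Lemma Z2_unitP (x y : Z2) : y * x = 1 -> Z2_unit x.
Proof. by move=> yx; apply/asboolP; exists y. Qed.

Lemma Z2_inv_out : {in [predC Z2_unit], Z2_inv =1 id}.
Proof.
by move=> x /negP nx; rewrite /Z2_inv; case: pselect => // e; case: nx; apply/asboolP.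
Qed.

HB.instance Definition _ :=
  GRing.ComNzRing_hasMulInverse.Build Z2 Z2_mulV Z2_unitP Z2_inv_out.

Lemma res0 n : res 0 n = 0%N.
Proof. exact: mod0n. Qed.

Lemma resD (x y : Z2) n : (res (x + y)%R n = (res x n + res y n) %% 2 ^ n)%N.
Proof. by []. Qed.

Lemma resM (x y : Z2) n : (res (x * y)%R n = (res x n * res y n) %% 2 ^ n)%N.
Proof. by []. Qed.

Lemma Z2_neq0 (x : Z2) : x != 0 -> exists n, res x n != 0%N.
Proof.
move=> x0; apply: contrapT => nx; case/eqP: x0; apply: Z2_eqP => n.
by rewrite res0; apply/eqP/negPn/negP => xn; apply: nx; exists n.
Qed.

(* the largest n such that 2^n divides x, for x != 0; the value at 0 is
   junk *)
Definition Z2_val (x : Z2) : nat :=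
  if pselect (exists n, res x n != 0%N) is left e then (ex_minn e).-1 else 0%N.

Lemma Z2_valE (x : Z2) n : res x n != 0%N -> Z2_val x = logn 2 (res x n).
Proof.
move=> xn; rewrite /Z2_val; case: pselect => [e|[]]; last by exists n.
case: ex_minnP => -[|m]; first by rewrite -(resS x 0) modn1.
move=> xm mP /=; have lemn : (m < n)%N by exact: mP.
have xm0 : res x m = 0%N.
  by apply/eqP/negPn/negP => /mP; rewrite ltnn.
have xn0 : (0 < res x n)%N by rewrite lt0n.
apply/eqP; rewrite eqn_leq -pfactor_dvdn // /dvdn (res_mod x (ltnW lemn)) xm0 eqxx.
by rewrite leqNgt -pfactor_dvdn // /dvdn (res_mod x lemn).
Qed.

Lemma Z2_val_lt (x : Z2) n : res x n != 0%N -> (Z2_val x < n)%N.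
Proof.
move=> xn; rewrite (Z2_valE xn) -(ltn_exp2l _ _ (isT : 1 < 2)%N).
apply: leq_ltn_trans (res_lt x n); apply: dvdn_leq; rewrite ?lt0n //.
exact: pfactor_dvdnn.
Qed.

Lemma res_neq0 (x : Z2) n : x != 0 -> (Z2_val x < n)%N -> res x n != 0%N.
Proof.
move=> /Z2_neq0[m xm] ltn; rewrite -(@res_mod x n (maxn m n)) ?leq_maxr //.
have xmn : res x (maxn m n) != 0%N.
  by apply: contra xm; rewrite -(@res_mod x m (maxn m n)) ?leq_maxl // => /eqP->; rewrite mod0n.
apply: contraL ltn => dv; rewrite -leqNgt (Z2_valE xmn).
by rewrite -pfactor_dvdn ?lt0n.
Qed.

Lemma res_eq0 (x : Z2) n : x != 0 -> (res x n == 0%N) = (n <= Z2_val x)%N.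
Proof.
move=> x0; apply/idP/idP; rewrite leqNgt; first by apply: contraTN; exact: res_neq0.
by apply: contraTT => /Z2_val_lt; rewrite negbK.
Qed.

Lemma Z2_val_mul (x y : Z2) : x != 0 -> y != 0 ->
  x * y != 0 /\ Z2_val (x * y) = (Z2_val x + Z2_val y)%N.
Proof.
move=> x0 y0; pose n := (Z2_val x + Z2_val y).+1.
have xn : res x n != 0%N by apply: res_neq0; rewrite // ltnS leq_addr.
have yn : res y n != 0%N by apply: res_neq0; rewrite // ltnS leq_addl.
have lM : logn 2 (res x n * res y n) = (Z2_val x + Z2_val y)%N.
  by rewrite lognM ?lt0n // -!Z2_valE.
have xyn : res (x * y) n != 0%N.
  apply/negP => dv.
  have : (n <= logn 2 (res x n * res y n))%N.
    by rewrite -pfactor_dvdn // muln_gt0 !lt0n xn.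
  by rewrite lM ltnn.
have xy0 : x * y != 0 by apply: contra xyn => /eqP->; rewrite res0.
split=> //; apply/eqP; rewrite eqn_leq; apply/andP; split.
  by have := Z2_val_lt xyn.
rewrite -res_eq0 // resM; apply/eqP/eqP.
have := pfactor_dvdnn 2 (res x (Z2_val x + Z2_val y) * res y (Z2_val x + Z2_val y)).
rewrite -(@res_mod x (Z2_val x + Z2_val y) n) // -(@res_mod y (Z2_val x + Z2_val y) n) //.
by rewrite modnMm => _; rewrite -/(dvdn _ _) pfactor_dvdn ?lM // muln_gt0 !lt0n xn.
Qed.

Lemma Z2_integral : GRing.integral_domain_axiom Z2.
Proof.
move=> x y xy0; case: eqVneq => //= x0; case: eqVneq => // y0.
by have [] := Z2_val_mul x0 y0; rewrite xy0 eqxx.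
Qed.

HB.instance Definition _ := GRing.ComUnitRing_isIntegral.Build Z2 Z2_integral.

Definition Q2 := {fraction Z2}.

HB.instance Definition _ := GRing.Field.on Q2.
HB.instance Definition _ := isPointed.Build Q2 0.

Section Norm.
Variable K : realFieldType.
Implicit Types x y : Z2.

Definition Z2_norm (x : Z2) : K := if x == 0 then 0 else 2^-1 ^+ Z2_val x.

Lemma Z2_norm_ge0 x : 0 <= Z2_norm x.
Proof. by rewrite /Z2_norm; case: ifP => // _; rewrite exprn_ge0 ?invr_ge0 ?ler0n. Qed.

Lemma Z2_norm_eq0 x : (Z2_norm x == 0) = (x == 0).
Proof.
rewrite /Z2_norm; case: ifP => [_|x0]; first by rewrite eqxx.
by rewrite expf_eq0 invr_eq0 pnatr_eq0 andbF.
Qed.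

Lemma Z2_normM : {morph Z2_norm : x y / x * y}.
Proof.
move=> x y; rewrite /Z2_norm mulf_eq0.
have [|x0] := eqVneq x 0; first by rewrite mul0r.
have [|y0] := eqVneq y 0; first by rewrite mulr0.
by have [_ ->] := Z2_val_mul x0 y0; rewrite exprD.
Qed.

Lemma Z2_norm1 : Z2_norm 1 = 1.
Proof.
have : Z2_norm 1 * Z2_norm 1 = Z2_norm 1 by rewrite -Z2_normM mulr1.
by move/(canRL (mulfK _)) => ->; rewrite ?divff // Z2_norm_eq0 oner_neq0.
Qed.

Lemma Z2_norm_le (x : Z2) n : (Z2_norm x <= 2^-1 ^+ n) = (res x n == 0%N).
Proof.
rewrite /Z2_norm; case: eqVneq => [->|x0].
  by rewrite res0 eqxx exprn_ge0 ?invr_ge0 ?ler0n.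
rewrite res_eq0 // ler_iXn2l ?invr_gt0 ?ltr0n ?invf_lt1 ?ltr1n //.
Qed.

Lemma Z2_normD x y : Z2_norm (x + y) <= Num.max (Z2_norm x) (Z2_norm y).
Proof.
wlog le_xy : x y / Z2_norm x <= Z2_norm y => [IH|].
  by case/orP: (le_total (Z2_norm x) (Z2_norm y)) => /IH; rewrite // addrC maxC.
rewrite (max_idPr le_xy); have [y0|y0] := eqVneq y 0.
  by move: le_xy; rewrite y0 addr0.
have Ey : Z2_norm y = 2^-1 ^+ Z2_val y by rewrite /Z2_norm (negPf y0).
have hy : Z2_norm y <= 2^-1 ^+ Z2_val y by rewrite Ey.
rewrite Ey in le_xy *; move: hy le_xy.
by rewrite !Z2_norm_le resD => /eqP-> /eqP->; rewrite mod0n.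
Qed.

Lemma Z2_normN x : Z2_norm (- x) = Z2_norm x.
Proof.
suff N1 : Z2_norm (-1) = 1 by rewrite -mulN1r Z2_normM N1 mul1r.
have : Z2_norm (-1) ^+ 2 = 1 by rewrite expr2 -Z2_normM mulrNN mulr1 Z2_norm1.
by move/eqP; rewrite sqrp_eq1 ?Z2_norm_ge0 // => /eqP.
Qed.

(* the value does not depend on the chosen fraction, see norm2_frac *)
Definition norm2 (x : Q2) : K :=
  let q : {ratio Z2} := repr x in Z2_norm (frac q).1 / Z2_norm (frac q).2.

Lemma norm2_pi (q : {ratio Z2}) :
  norm2 (\pi_Q2 q)%qT = Z2_norm (frac q).1 / Z2_norm (frac q).2.
Proof.
apply/eqP; rewrite eqr_div ?Z2_norm_eq0 ?denom_ratioP // -!Z2_normM.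
by rewrite FracField.equivf_l mulrC.
Qed.

Lemma norm2_frac (n d : Z2) : d != 0 ->
  norm2 (FracField.tofrac n / FracField.tofrac d) = Z2_norm n / Z2_norm d.
Proof.
move=> d0; have -> : FracField.tofrac n / FracField.tofrac d
    = (\pi_Q2 (Ratio n d))%qT.
  rewrite /GRing.mul /GRing.inv /= !piE /FracField.invf.
  by rewrite /FracField.mulf !numden_Ratio ?oner_eq0 // mulr1 mul1r.
by rewrite norm2_pi !numden_Ratio.
Qed.

Lemma fracP (x : Q2) : exists n d : Z2, d != 0 /\
  x = FracField.tofrac n / FracField.tofrac d.
Proof.
elim/quotW: x => q; exists (frac q).1, (frac q).2; split; first exact: denom_ratioP.
rewrite -{1}[q]Ratio_numden.
rewrite /GRing.mul /GRing.inv /= !piE /FracField.invf.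
by rewrite /FracField.mulf !numden_Ratio ?oner_eq0 ?denom_ratioP // mulr1 mul1r.
Qed.

Lemma norm2_int (n : Z2) : norm2 (FracField.tofrac n) = Z2_norm n.
Proof.
rewrite -[FracField.tofrac n]divr1 -(rmorph1 (@FracField.tofrac Z2)).
by rewrite norm2_frac ?oner_neq0 // Z2_norm1 divr1.
Qed.

Lemma norm2_ge0 (x : Q2) : 0 <= norm2 x.
Proof. by rewrite divr_ge0 ?Z2_norm_ge0. Qed.

Lemma norm2_eq0 (x : Q2) : (norm2 x == 0) = (x == 0).
Proof.
have [n [d [d0 ->]]] := fracP x; rewrite norm2_frac //.
by rewrite !mulf_eq0 !invr_eq0 !Z2_norm_eq0 !tofrac_eq0.
Qed.

Lemma norm2M : {morph norm2 : x y / x * y}.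
Proof.
move=> x y; have [n [d [d0 ->]]] := fracP x; have [m [e [e0 ->]]] := fracP y.
rewrite mulf_div -!rmorphM /= !norm2_frac ?mulf_neq0 // !Z2_normM.
by rewrite mulf_div.
Qed.

Lemma norm2N (x : Q2) : norm2 (- x) = norm2 x.
Proof.
have [n [d [d0 ->]]] := fracP x.
by rewrite -mulNr -rmorphN /= !norm2_frac // Z2_normN.
Qed.

Lemma norm2D (x y : Q2) : norm2 (x + y) <= Num.max (norm2 x) (norm2 y).
Proof.
have [n [d [d0 ->]]] := fracP x; have [m [e [e0 ->]]] := fracP y.
rewrite addf_div ?tofrac_eq0 // -!rmorphM -rmorphD /= !norm2_frac ?mulf_neq0 //.
rewrite Z2_normM ler_pdivrMr; last first.
  by rewrite lt_def mulf_neq0 ?Z2_norm_eq0 // mulr_ge0 ?Z2_norm_ge0.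
apply: le_trans (Z2_normD _ _) _.
rewrite maxr_pMl ?mulr_ge0 ?Z2_norm_ge0 // !Z2_normM.
rewrite [X in _ <= Num.max _ (_ * X)]mulrC !mulrA !divfK ?Z2_norm_eq0 //.
Qed.

Lemma norm2_2 : norm2 2 = 2^-1.
Proof.
have -> : (2 : Q2) = FracField.tofrac 2 by rewrite rmorph_nat.
rewrite norm2_int.
have r2 : res 2 2 = 2%N by [].
have nz : (2 : Z2) != 0 by apply: contraPN r2 => /eqP->; rewrite res0.
by rewrite /Z2_norm (negPf nz) (@Z2_valE _ 2) r2.
Qed.

End Norm.

Definition dist2 (x y : Q2) : rat := norm2 rat (x - y).

Lemma dist2xx x : dist2 x x = 0.
Proof. by apply/eqP; rewrite /dist2 subrr norm2_eq0. Qed.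

Lemma dist2_positivity x y : dist2 x y = 0 -> x = y.
Proof. by move/eqP; rewrite norm2_eq0 subr_eq0 => /eqP. Qed.

Lemma dist2_sym x y : dist2 x y = dist2 y x.
Proof. by rewrite /dist2 -opprB norm2N. Qed.

Lemma dist2_triangle y x z : dist2 x z <= dist2 x y + dist2 y z.
Proof.
rewrite /dist2 -[x - z](subrKA y); apply: le_trans (norm2D _ _ _) _.
by rewrite ge_max lerDl lerDr !norm2_ge0.
Qed.

(* Q2 as a metric space; since all distances are rational, the metric is taken
   over rat so that the topology does not depend on a model of the reals. *)
HB.instance Definition _ :=
  isMetric.Build rat Q2 dist2xx dist2_positivity dist2_sym dist2_triangle.

Definition borelQ2 := g_sigma_algebraType (@open Q2).

Section Spheres.
Variable R : realType.

Definition ball2 (rho : R) (s : Q2) : set Q2 := [set x | norm2 R (x - s) <= rho].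

Definition sphere2 (rho : R) (s : Q2) : set Q2 := [set x | norm2 R (x - s) = rho].

Definition norm2_value (rho : R) : Prop := exists k : int, rho = 2 ^ k.

Definition is_haar2 (m : {measure set borelQ2 -> \bar R}) : Prop :=
  (forall (t : Q2) (A : set borelQ2), measurable A ->
     m [set t + x | x in (A : set Q2)] = m A) /\
  (forall (s : Q2) (rho : R), norm2_value rho -> m (ball2 rho s) = rho%:E).

(* the normalization of m restricted to the sphere; meant for m (sphere2 r s)
   finite and nonzero *)
Definition sphere_measure (m : {measure set borelQ2 -> \bar R}) (r : R) (s : Q2)
    (V : set borelQ2) : \bar R :=
  (m (V `&` sphere2 r s) * ((fine (m (sphere2 r s)))^-1)%:E)%E.

(* The Borel subsets of the sphere, which is itself a Borel set, are the Borel
   subsets of Q2 that it contains. *)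
Definition ergodic (X : set borelQ2) (f : Q2 -> Q2)
    (mu : set borelQ2 -> \bar R) : Prop :=
  forall V : set borelQ2, measurable V -> V `<=` X -> f @` V `<=` V ->
    mu V = 0%E \/ mu V = 1%E.

Definition radii (alpha beta : R) : set R :=
  if alpha == beta then [set r | 0 < r /\ r != beta]
  else [set r | 0 < r /\ r > Num.max alpha beta].

End Spheres.

(* The junk value f (- c) = 0 is irrelevant on spheres avoiding - c. *)
Definition ratfun (a b c x : Q2) : Q2 := (x ^+ 2 + a * x + b) / (x + c).

(* Main.v *)
(* Put A = x0 + a, B = x0 + c and y = x - x0; then f acts on the sphere |y| = r
   by y |-> y (y + A) / (y + B).

   Ergodic case: |f x - x| = r / 2, and f differs from a translation by a
   contraction of ratio 1/4, as do all its iterates. Hence doubling the number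
   of iterations halves the displacement, |f^(2^n) x - x| = r / 2^(n+1), and
   since the residue field has two elements every orbit is dense. So f preserves
   the measure, an invariant set has the same mass in all balls of a given
   radius, and its trace is proportional to the measure of the sphere; applied
   to the set itself this gives m(V) m(S) = m(V)^2.

   Other cases: either f fixes every ball of radius r / 4 of the sphere, or
   (alpha = beta > r) f o f fixes every ball of radius r / 8, so that a ball and
   its image form an invariant set of measure at most half of the sphere. *)
Require Import Defs.
From mathcomp Require Import all_boot all_order all_algebra.
From mathcomp Require Import all_classical all_reals all_analysis.
From mathcomp Require Import ring lra.

Set Implicit Arguments.
Unset Strict Implicit.
Unset Printing Implicit Defensive.

Import Order.TTheory GRing.Theory Num.Theory.

Local Open Scope classical_set_scope.
Local Open Scope ring_scope.

(** * The 2-adic norm: discreteness of its values and the ultrametric inequality *)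

Section NormFacts.
Variable R : realType.
Implicit Types (x y : Q2) (r s : R).
Local Notation N := (norm2 R).

Lemma half_expz (k : int) : (2 : R) ^ k / 2 = 2 ^ (k - 1).
Proof. by rewrite expfzDr ?pnatr_eq0 // expfzN1. Qed.

Lemma norm2_value_gt0 r : norm2_value r -> 0 < r.
Proof. by move=> [k ->]; rewrite exprz_gt0. Qed.

Lemma norm2_value_half r : norm2_value r -> norm2_value (r / 2).
Proof. by move=> [k ->]; exists (k - 1); rewrite half_expz. Qed.

Lemma norm2_value_divX r n : norm2_value r -> norm2_value (r / 2 ^+ n).
Proof.
move=> vr; elim: n => [|n IHn]; first by rewrite expr0 divr1.
by rewrite exprSr invfM mulrA; apply: norm2_value_half.
Qed.

Lemma norm2_value_lt r s : norm2_value r -> norm2_value s -> r < s -> r <= s / 2.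
Proof.
move=> [i ->] [j ->]; rewrite half_expz ltr_eXz2l ?ler_eXz2l ?ltr1n //.
by rewrite lerBrDr lezD1.
Qed.

(** If the common norm is 2^-v, both residues modulo 2^(v+1) are nonzero multiples of 2^v, hence
    equal to 2^v, and they cancel in the difference. *)
Lemma Z2_norm_halve (x y : Z2) :
  Z2_norm R x = Z2_norm R y -> Z2_norm R (x - y) <= Z2_norm R x / 2.
Proof.
move=> exy; have [x0|x0] := eqVneq x 0.
  have y0 : y = 0 by apply/eqP; rewrite -(Z2_norm_eq0 R) -exy Z2_norm_eq0 x0.
  by rewrite x0 y0 subrr /Z2_norm eqxx mul0r.
have y0 : y != 0 by rewrite -(Z2_norm_eq0 R) -exy Z2_norm_eq0.
set v := Z2_val x.
have Nx : Z2_norm R x = 2^-1 ^+ v by rewrite /Z2_norm (negPf x0).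
have Ny : Z2_norm R y = 2^-1 ^+ v by rewrite -exy.
have res_top (z : Z2) : Z2_norm R z = 2^-1 ^+ v -> res z v.+1 = (2 ^ v)%N.
  move=> Nz; have zv : res z v = 0%N by apply/eqP; rewrite -(Z2_norm_le R) Nz.
  have zv1 : res z v.+1 != 0%N.
    by rewrite -(Z2_norm_le R) -ltNge Nz ltr_iXn2l ?invr_gt0 ?invf_lt1 ?ltr1n.
  have lt := res_lt z v.+1.
  have /dvdnP[q eq] : (2 ^ v %| res z v.+1)%N by rewrite /dvdn resS zv.
  move: lt zv1; rewrite eq expnS ltn_pmul2r ?expn_gt0 //.
  by case: q {eq} => [|[|]] //; rewrite mul1n.
have -> : Z2_norm R x / 2 = 2^-1 ^+ v.+1 by rewrite Nx exprSr.
rewrite Z2_norm_le resD /= !res_top // modnDmr subnKC ?modnn //.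
by rewrite leq_exp2l.
Qed.

Lemma norm2_halve x y : N x = N y -> N (x - y) <= N x / 2.
Proof.
have [n [d [d0 ->]]] := fracP x; have [m [e [e0 ->]]] := fracP y.
(* Over the common denominator [d * e], the numerators [n * e] and [m * d] have equal norms, which
   reduces the claim to the integral case. *)
rewrite -mulNr addf_div ?tofrac_eq0 // -rmorphN -!rmorphM -rmorphD /=.
rewrite !norm2_frac ?mulf_neq0 // => /eqP.
rewrite eqr_div ?Z2_norm_eq0 // => /eqP exy.
rewrite mulNr; apply: le_trans (_ : Z2_norm R (n * e) / 2 / Z2_norm R (d * e) <= _).
  rewrite ler_wpM2r ?invr_ge0 ?Z2_norm_ge0 // Z2_norm_halve //.
  by rewrite !Z2_normM exy.
by rewrite !Z2_normM mulrAC invfM [_^-1 / _]mulrC mulrA mulfK ?Z2_norm_eq0.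
Qed.

Lemma norm2_is_value x : x != 0 -> norm2_value (N x).
Proof.
have [n [d [d0 ->]]] := fracP x; rewrite mulf_eq0 invr_eq0 !tofrac_eq0 (negPf d0) orbF.
move=> n0; rewrite norm2_frac // /Z2_norm (negPf n0) (negPf d0).
exists (Posz (Z2_val d) - Posz (Z2_val n)).
by rewrite expfzDr ?pnatr_eq0 // -invr_expz exprVn exprVn invrK mulrC.
Qed.

Lemma norm2_lt_half x r : norm2_value r -> N x < r -> N x <= r / 2.
Proof.
move=> vr; have [->|x0] := eqVneq x 0.
  move=> _; have /eqP-> : N 0 == 0 by rewrite norm2_eq0.
  by rewrite divr_ge0 // ltW // norm2_value_gt0.
by apply: norm2_value_lt => //; apply: norm2_is_value.
Qed.

Lemma norm2_0 : N 0 = 0.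
Proof. by apply/eqP; rewrite norm2_eq0. Qed.

Lemma norm2_1 : N 1 = 1.
Proof. by rewrite -(rmorph1 (@FracField.tofrac Z2)) norm2_int Z2_norm1. Qed.

Lemma norm2V x : N x^-1 = (N x)^-1.
Proof.
have [->|x0] := eqVneq x 0; first by rewrite invr0 norm2_0 invr0.
have Nx : N x != 0 by rewrite norm2_eq0.
by apply: (mulfI Nx); rewrite -norm2M !divff // norm2_1.
Qed.

Lemma norm2X x n : N (x ^+ n) = N x ^+ n.
Proof. by elim: n => [|n IHn]; rewrite ?expr0 ?norm2_1 // !exprS norm2M IHn. Qed.

Lemma norm2_addr_le x y r : N x <= r -> N y <= r -> N (x + y) <= r.
Proof. by move=> xr yr; apply: le_trans (norm2D _ _ _) _; rewrite ge_max xr. Qed.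

Lemma norm2_distC x y : N (x - y) = N (y - x).
Proof. by rewrite -opprB norm2N. Qed.

Lemma norm2_dist_le z x y r : N (x - z) <= r -> N (z - y) <= r -> N (x - y) <= r.
Proof. by move=> xz zy; rewrite -(subrKA z); apply: norm2_addr_le. Qed.

(** Otherwise y = (x + y) - x would be a sum of two terms of norm below |y|. *)
Lemma norm2_addl_lt x y : N x < N y -> N (x + y) = N y.
Proof.
move=> xy; apply/eqP; rewrite eq_le (norm2_addr_le (ltW xy) (lexx _)) leNgt.
apply/negP => h.
have : N (x + y - x) < N y.
  by apply: le_lt_trans (norm2D _ _ _) _; rewrite norm2N gt_max h.
by rewrite addrC addKr ltxx.
Qed.

Lemma norm2_value_ex r : norm2_value r -> exists x, N x = r.
Proof.
by move=> [[k|k] ->]; [exists (2^-1 ^+ k)|exists (2 ^+ k.+1)];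
  rewrite norm2X ?norm2V norm2_2 ?invrK // exprVn.
Qed.

(* The residue field of Q2 has two elements, so a sphere is a single ball. *)
Lemma sphere2_ball r (s y : Q2) : norm2_value r -> sphere2 r s y ->
  sphere2 r s = ball2 (r / 2) y.
Proof.
move=> vr ys; have r0 := norm2_value_gt0 vr.
apply/seteqP; split=> x; rewrite /sphere2 /ball2 /= in ys *.
  move=> xs; have -> : x - y = (x - s) - (y - s) by rewrite opprB subrKA.
  by rewrite -xs; apply: norm2_halve; rewrite xs.
move=> xy; have -> : x - s = (x - y) + (y - s) by rewrite subrKA.
rewrite norm2_addl_lt ys //; apply: le_lt_trans xy _.
by rewrite ltr_pdivrMr // ltr_pMr ?ltr1n.
Qed.

End NormFacts.

(** * Balls, open sets and a generating family of the Borel sets *)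

Section Topology.
Variable R : realType.
Implicit Types (x y s : Q2) (r rho : R).
Local Notation N := (norm2 R).

(** Links the metric, which is rational, to the real-valued norm that measures use. *)
Lemma norm2_ratr x : N x = ratr (norm2 rat x).
Proof.
have Z2_ratr (z : Z2) : Z2_norm R z = ratr (Z2_norm rat z).
  rewrite /Z2_norm; case: ifP => _; first by rewrite rmorph0.
  by rewrite rmorphXn fmorphV rmorph_nat.
have [n [d [d0 ->]]] := fracP x.
by rewrite !norm2_frac // !Z2_ratr fmorph_div.
Qed.

Lemma exists_half_expr_lt (K : archiRealFieldType) (e : K) :
  0 < e -> exists n, 2^-1 ^+ n < e.
Proof.
move=> e0; exists (Num.bound e^-1); rewrite exprVn invf_plt ?posrE ?exprn_gt0 //.
have ie0 : 0 <= e^-1 by rewrite invr_ge0 ltW.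
apply: lt_le_trans (archi_boundP ie0) _.
by rewrite -natrX ler_nat ltnW // ltn_expl.
Qed.

Lemma open_ball2P (U : set Q2) :
  open U <-> forall x, U x -> exists n, ball2 (2^-1 ^+ n : R) x `<=` U.
Proof.
have ratrX n : 2^-1 ^+ n = ratr (2^-1 ^+ n) :> R.
  by rewrite rmorphXn fmorphV rmorph_nat.
rewrite openE; split=> [oU x /oU|oU x Ux].
  move=> /nbhs_ballP[e /= e0 eU].
  have [n ne] := exists_half_expr_lt e0; exists n => y; rewrite /ball2 /=.
  rewrite ratrX norm2_ratr ler_rat => yx; apply: eU.
  by rewrite ballEmdist /=; apply: le_lt_trans ne; rewrite metric_sym.
have [n nU] := oU x Ux; apply/nbhs_ballP; exists (2^-1 ^+ n) => /=.
  by rewrite exprn_gt0 ?invr_gt0.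
move=> y; rewrite ballEmdist /= metric_sym => /ltW yx; apply: nU.
by rewrite /ball2 /= ratrX norm2_ratr ler_rat.
Qed.

Lemma open_ball2 rho s : 0 < rho -> open (ball2 rho s).
Proof.
move=> /exists_half_expr_lt[n nrho]; apply/open_ball2P => x xs; exists n => y yx.
exact: norm2_dist_le (le_trans yx (ltW nrho)) xs.
Qed.

Lemma measurable_open2 (U : set borelQ2) : open (U : set Q2) -> measurable U.
Proof. exact: sub_sigma_algebra. Qed.

Lemma measurable_ball2 rho s : 0 < rho -> measurable (ball2 rho s : set borelQ2).
Proof. by move=> rho0; apply: measurable_open2; apply: open_ball2. Qed.

Lemma ball2_eq rho x y : ball2 rho x y -> ball2 rho y = ball2 rho x.
Proof.
rewrite /ball2 /= => yx; apply/seteqP; split=> z /= zx.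
  exact: norm2_dist_le zx yx.
by apply: norm2_dist_le zx _; rewrite norm2_distC.
Qed.

Lemma ball2_refl rho x : 0 <= rho -> ball2 rho x x.
Proof. by rewrite /ball2 /= subrr norm2_0. Qed.

Lemma subset_ball2 rho rho' x : rho <= rho' -> ball2 rho x `<=` ball2 rho' x.
Proof. by move=> le y yx; apply: le_trans yx le. Qed.

Definition ball_system : set (set borelQ2) :=
  [set A | A = set0 \/ exists s, exists2 rho : R, norm2_value rho & A = ball2 rho s].

(** Any point of a ball is a centre of it, so two balls that meet can be recentred at a common point
    and are then nested. *)
Lemma setI_closed_ball_system : setI_closed ball_system.
Proof.
move=> A B [->|[s [rho vrho ->]]]; first by rewrite set0I; left.
case=> [->|[s' [rho' vrho' ->]]]; first by rewrite setI0; left.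
have [|/set0P[x [xs xs']]] := eqVneq (ball2 rho s `&` ball2 rho' s') set0; first by left.
right; rewrite -(ball2_eq xs) -(ball2_eq xs').
have [le|/ltW le] := leP rho rho'; exists x.
  by exists rho => //; rewrite setIidl //; apply: subset_ball2.
by exists rho' => //; rewrite setIidr //; apply: subset_ball2.
Qed.

Lemma exists_nat_near n y : N y <= 1 -> exists i : nat, N (y - i%:R) <= 2^-1 ^+ n.
Proof.
elim: n y => [|n IHn] y y1; first by exists 0%N; rewrite subr0 expr0.
(* [e] is the lowest binary digit of [y]; the induction hypothesis is applied to the remaining
   digits, (y - e) / 2. *)
have [e ye] : exists e : nat, N (y - e%:R) <= 2^-1.
  have [y_half|y_half] := leP (N y) 2^-1; first by exists 0%N; rewrite subr0.
  have Ny : N y = 1.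
    apply/eqP; rewrite eq_le y1 leNgt; apply/negP => /norm2_lt_half.
    by rewrite mul1r leNgt y_half => /(_ (ex_intro _ 0 erefl)).
  exists 1%N; have : N y = N 1 by rewrite norm2_1.
  by move/norm2_halve; rewrite Ny mul1r.
have [|i iP] := IHn ((y - e%:R) / 2).
  by rewrite norm2M norm2V norm2_2 invrK -ler_pdivlMr // mul1r.
exists (e + i * 2)%N; have -> : y - (e + i * 2)%:R = 2 * ((y - e%:R) / 2 - i%:R).
  rewrite natrD natrM mulrBr [2 * (_ / 2)]mulrC divfK; last first.
    by rewrite -(norm2_eq0 R) norm2_2 invr_eq0 pnatr_eq0.
  by rewrite mulrC opprD addrA.
by rewrite norm2M norm2_2 exprS ler_pM2l ?invr_gt0.
Qed.

Lemma exists_dyadic_near x n :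
  exists ij : nat * nat, N (x - ij.1%:R / 2 ^+ ij.2) <= 2^-1 ^+ n.
Proof.
have two0 : (2 : Q2) != 0 by rewrite -(norm2_eq0 R) norm2_2 invr_eq0 pnatr_eq0.
have [j jP] : exists j, N (x * 2 ^+ j) <= 1.
  have [->|x0] := eqVneq x 0; first by exists 0%N; rewrite mul0r norm2_0.
  have Nx : 0 < N x by rewrite lt_neqAle norm2_ge0 eq_sym norm2_eq0 x0.
  have [|j /ltW jP] := @exists_half_expr_lt R (N x)^-1; first by rewrite invr_gt0.
  by exists j; rewrite norm2M norm2X norm2_2 mulrC -ler_pdivlMr // mul1r.
have [i iP] := exists_nat_near (n + j) jP; exists (i, j) => /=.
have -> : x - i%:R / 2 ^+ j = (x * 2 ^+ j - i%:R) / 2 ^+ j.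
  by rewrite mulrBl mulfK // expf_neq0.
rewrite norm2M norm2V norm2X norm2_2 ler_pdivrMr ?exprn_gt0 ?invr_gt0 //.
by rewrite -exprD.
Qed.

(** Balls of radius 2^-n centred at dyadic rationals form a countable base of the topology. *)
Lemma measurable_borelQ2E : @measurable _ borelQ2 = <<s ball_system >>.
Proof.
apply/seteqP; split; last first.
  apply: smallest_sub; first exact: sigma_algebra_measurable.
  move=> A [->|[s [rho /norm2_value_gt0 rho0 ->]]] //; exact: measurable_ball2.
apply: smallest_sub; first exact: smallest_sigma_algebra.
move=> U /open_ball2P oU.
pose B (t : nat * nat * nat) : set Q2 := ball2 (2^-1 ^+ t.2 : R) (t.1.1%:R / 2 ^+ t.1.2).
(* Base balls not contained in [U] are replaced by the empty set, so that the union runs over a full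
   countable type. *)
pose F t := if `[< B t `<=` U >] then B t else set0.
have -> : U = \bigcup_t F t.
  apply/seteqP; split=> [x Ux|x [t _]]; last first.
    by rewrite /F; case: asboolP => // BU /BU.
  have [n nU] := oU x Ux; have [ij xij] := exists_dyadic_near x n.
  have Bx : B (ij, n) x by [].
  exists (ij, n) => //; rewrite /F; case: asboolP => // -[].
  by rewrite /B -(ball2_eq Bx).
apply: (@countable_bigcupT_measurable _ (g_sigma_algebraType ball_system)) => // t.
apply: sub_sigma_algebra; rewrite /F; case: ifP => _; last by left.
right; exists (t.1.1%:R / 2 ^+ t.1.2), (2^-1 ^+ t.2) => //.
by exists (- (t.2 : int)); rewrite -invr_expz exprVn.
Qed.

End Topology.

(** * Uniqueness of finite measures concentrated on a ball *)

Section MeasureOnBall.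
Variable R : realType.
Implicit Types (x y s : Q2) (r rho : R).
Local Notation N := (norm2 R).

Lemma conull_measureI (m : {measure set borelQ2 -> \bar R}) (B A : set borelQ2) :
  measurable B -> measurable A -> m (~` B) = 0%E -> m A = m (A `&` B).
Proof.
move=> mB mA mB0; rewrite -{1}(setUIDK A B) measureU //.
- rewrite [X in (_ + X)%E](_ : _ = 0%E) ?adde0 //.
  apply: (subset_measure0 _ _ _ mB0); [exact: measurableD|exact: measurableC|].
  by move=> x [].
- exact: measurableI.
- exact: measurableD.
- by rewrite setDE setIACA setICr setI0.
Qed.

(** Balls form a pi-system generating the Borel sets. A ball either misses the given one, is
    contained in it or contains it, so only the balls inside need comparing. *)
Lemma measure_ball2_ext (m1 m2 : {measure set borelQ2 -> \bar R}) rho y0 :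
  norm2_value rho -> (m1 (ball2 rho y0) < +oo)%E ->
  m1 (~` ball2 rho y0) = 0%E -> m2 (~` ball2 rho y0) = 0%E ->
  (forall n y, ball2 rho y0 y ->
     m1 (ball2 (rho / 2 ^+ n) y) = m2 (ball2 (rho / 2 ^+ n) y)) ->
  forall A : set borelQ2, measurable A -> m1 A = m2 A.
Proof.
move=> vrho m1oo m10 m20 m12; have rho0 := norm2_value_gt0 vrho.
have mB : measurable (ball2 rho y0 : set borelQ2) by exact: measurable_ball2.
have v2 n : norm2_value (2 ^+ n : R) by exists n.
(* An exhausting sequence of members of the pi-system, each of finite measure. *)
pose g n : set borelQ2 := ball2 (2 ^+ n : R) 0.
have mg n : measurable (g n) by apply: measurable_ball2; rewrite exprn_gt0.
apply: (measure_unique (ball_system R) g).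
- exact: measurable_borelQ2E.
- exact: setI_closed_ball_system.
- by move=> n; right; exists 0, (2 ^+ n).
- rewrite -subTset => x _; exists (Num.bound (N x)) => //; rewrite /g /ball2 /= subr0.
  apply: ltW; apply: lt_le_trans (archi_boundP (norm2_ge0 _ _)) _.
  by rewrite -natrX ler_nat ltnW // ltn_expl.
- move=> A [->|[s [rho' vrho' ->]]]; first by rewrite !measure0.
  have mA : measurable (ball2 rho' s : set borelQ2).
    by apply: measurable_ball2; apply: norm2_value_gt0.
  rewrite (conull_measureI mB mA m10) (conull_measureI mB mA m20).
  have [->|/set0P[x [xs xy0]]] := eqVneq (ball2 rho' s `&` ball2 rho y0) set0.
    by rewrite !measure0.
  rewrite -(ball2_eq xs) -(ball2_eq xy0).
  have [le|/ltW le] := leP rho' rho.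
    rewrite setIidl; last exact: subset_ball2.
    have [n ->] : exists n, rho' = rho / 2 ^+ n; last exact: m12.
    case: vrho vrho' le => j -> [i ->]; rewrite ler_eXz2l ?ltr1n // => ij.
    exists `|j - i|%N; have -> : (2 : R) ^+ `|j - i|%N = 2 ^ (j - i).
      have ji0 : 0 <= j - i by rewrite subr_ge0.
      by rewrite -[in RHS](gez0_abs ji0).
    by rewrite expfzDr ?pnatr_eq0 // -invr_expz invfM invrK mulVKf ?expfz_neq0 ?pnatr_eq0.
  rewrite setIidr; last exact: subset_ball2.
  by have := m12 0%N x xy0; rewrite expr0 divr1.
- move=> n; rewrite (conull_measureI mB (mg n) m10).
  by apply: le_lt_trans m1oo; rewrite le_measure ?inE //; exact: measurableI.
Qed.

End MeasureOnBall.

(** * Ergodicity of an almost-translation on a ball *)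

Section ErgodicOnBall.
Variables (R : realType) (m : {measure set borelQ2 -> \bar R}).
Local Notation N := (norm2 R).
Hypothesis mball : forall s rho, norm2_value rho -> m (ball2 rho s) = rho%:E.
Variables (rho : R) (y0 : Q2) (f : Q2 -> Q2).
Hypothesis vrho : norm2_value rho.
Local Notation B := (ball2 rho y0).
Hypothesis fB : forall x, B x -> B (f x).
Hypothesis f_move : forall x, B x -> N (f x - x) = rho.
Hypothesis f_almost_translation :
  forall x y, B x -> B y -> N (f x - f y - (x - y)) <= N (x - y) / 4.

Let rho0 : 0 < rho. Proof. exact: norm2_value_gt0. Qed.

Let radius n : R := rho / 2 ^+ n.

Let vradius n : norm2_value (radius n). Proof. exact: norm2_value_divX. Qed.

Let radius_gt0 n : 0 < radius n. Proof. exact: norm2_value_gt0. Qed.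

Let radiusS n : radius n.+1 = radius n / 2.
Proof. by rewrite /radius exprSr invfM mulrA. Qed.

Let radius_le n : radius n <= rho.
Proof.
rewrite /radius ler_pdivrMr ?exprn_gt0 //.
by apply: ler_peMr; [exact: ltW|rewrite exprn_ege1 ?ler1n].
Qed.

Let mB : measurable (B : set borelQ2). Proof. exact: measurable_ball2. Qed.

Let y0B : B y0. Proof. by apply: ball2_refl; exact: ltW. Qed.

Lemma norm2_close (u v : Q2) : N (u - v) <= N v / 4 -> N u = N v.
Proof.
have [->|v0] := eqVneq v 0.
  rewrite subr0 norm2_0 mul0r => u0; apply/eqP.
  by rewrite eq_le u0 norm2_ge0.
move=> uv; rewrite -[u](subrK v) norm2_addl_lt //; apply: le_lt_trans uv _.
by rewrite ltr_pdivrMr // ltr_pMr ?ltr1n // lt_neqAle norm2_ge0 eq_sym norm2_eq0 v0.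
Qed.

Lemma iter_ball k x : B x -> B (iter k f x).
Proof. by move=> Bx; elim: k => //= k; apply: fB. Qed.

(** Each further step adds an error of at most a quarter of |f^k x - f^k y|, which equals |x - y|;
    by the ultrametric inequality the errors do not accumulate. *)
Lemma iter_almost_translation k x y : B x -> B y ->
  N (iter k f x - iter k f y - (x - y)) <= N (x - y) / 4.
Proof.
move=> Bx By; elim: k => [|k IHk] /=.
  by rewrite subrr norm2_0 divr_ge0 ?norm2_ge0.
apply: norm2_dist_le (IHk); rewrite -(norm2_close IHk).
by apply: f_almost_translation; apply: iter_ball.
Qed.

Lemma iter_isometry k x y : B x -> B y -> N (iter k f x - iter k f y) = N (x - y).
Proof. by move=> Bx By; apply/norm2_close/iter_almost_translation. Qed.

(* Doubling the number of iterations halves the displacement: with w = f^k x,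
   f^(2k) x - x is 2 (w - x) up to an error of norm at most |w - x| / 4. *)
Lemma iter_pow2_move n x : B x -> N (iter (2 ^ n) f x - x) = radius n.
Proof.
move=> Bx; elim: n => [|n IHn]; first by rewrite /radius expr0 divr1 f_move.
rewrite expnS mul2n -addnn iterD; set w := iter (2 ^ n) f x in IHn *.
have Bw : B w by apply: iter_ball.
have err := iter_almost_translation (2 ^ n) Bw Bx; rewrite -/w IHn in err.
have N2w : N (2 * (w - x)) = radius n.+1 by rewrite norm2M norm2_2 IHn radiusS mulrC.
have -> : iter (2 ^ n) f w - x
    = (iter (2 ^ n) f w - w - (w - x)) + 2 * (w - x).
  rewrite mulr_natl mulr2n; move: (iter _ _ _) => u.
  by rewrite addrA subrK subrKA.
rewrite norm2_addl_lt // N2w; apply: le_lt_trans err _.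
by rewrite radiusS ltr_pM2l // ltf_pV2 ?posrE ?ltr_nat.
Qed.

Lemma orbit_dense n x y : B x -> B y ->
  exists k, ball2 (radius n) y (iter k f x).
Proof.
move=> Bx By; elim: n => [|n [k kP]].
  exists 0%N; rewrite /= /radius expr0 divr1; apply: norm2_dist_le (Bx) _.
  by rewrite norm2_distC.
have Bw : B (iter k f x) by apply: iter_ball.
have [lt|ge] := ltP (N (iter k f x - y)) (radius n).
  by exists k; rewrite /ball2 /= radiusS; apply: norm2_lt_half.
(* The orbit point [w] lies at distance exactly [radius n] from [y]. Moving it by 2^n steps
   displaces it by the same distance, and a difference of two vectors of equal norm has at most half
   that norm. *)
have Nw : N (iter k f x - y) = radius n by apply/eqP; rewrite eq_le ge andbT.
exists (2 ^ n + k)%N; rewrite iterD /ball2 /=; set w := iter k f x in Bw Nw *.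
have Nv := iter_pow2_move n Bw; set v := iter _ _ _ in Nv *.
have -> : v - y = (v - w) - (y - w) by rewrite opprB subrKA.
by rewrite radiusS -Nv; apply: norm2_halve; rewrite Nv norm2_distC Nw.
Qed.

(* Nothing is known about [f] outside the ball, not even measurability. *)
Let g x := if x \in B then f x else x.

Let gE x : B x -> g x = f x. Proof. by rewrite /g => Bx; rewrite mem_set. Qed.

Let g_out x : ~ B x -> g x = x. Proof. by rewrite /g => Bx; rewrite memNset. Qed.

Let gB x : B (g x) <-> B x.
Proof.
split=> [|Bx]; last by rewrite gE //; apply: fB.
by have [//|nBx] := pselect (B x); rewrite g_out.
Qed.

(** [g] is continuous: a ball of radius at most [rho] lies inside [B] or misses it, and [g] is an
    isometry on [B] and the identity elsewhere. *)
Let measurable_g : measurable_fun [set: borelQ2] (g : borelQ2 -> borelQ2).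
Proof.
apply: (@measurability _ _ borelQ2 borelQ2 setT g (@open Q2)) => // _ [U oU <-].
rewrite setTI.
apply: measurable_open2; apply/(open_ball2P R) => x Ugx.
have /(open_ball2P R)/(_ _ Ugx)[n nU] := oU.
have [|k] := @exists_half_expr_lt R (Num.min rho (2^-1 ^+ n)).
  by rewrite lt_min rho0 exprn_gt0 ?invr_gt0.
rewrite lt_min => /andP[/ltW krho /ltW kn]; exists k => y yx; apply: nU.
have By : B y <-> B x.
  have xy : ball2 rho x y by apply: subset_ball2 krho _ yx.
  have yx' := ball2_eq xy.
  split=> [By|Bx]; [rewrite -(ball2_eq By) yx'|rewrite -(ball2_eq Bx) -yx'];
    by apply: ball2_refl; exact: ltW.
apply: subset_ball2 kn _ _; rewrite /ball2 /=.
have [Bx|nBx] := pselect (B x); last by rewrite !g_out // By.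
by rewrite !gE ?By // (iter_isometry 1) ?By.
Qed.

Let measurable_preim (A : set borelQ2) : measurable A ->
  measurable (g @^-1` A : set borelQ2).
Proof. by move=> mA; rewrite -[X in measurable X]setTI; exact: measurable_g. Qed.

Let preim_ball n y : B y ->
  exists2 x, B x & (g @^-1` ball2 (radius n) y) `&` B = ball2 (radius n) x.
Proof.
(* The orbit is started at [f y0] rather than [y0], so that its point near [y] is the image of a
   point of [B]. *)
move=> By; have [k] := orbit_dense n (fB y0B) By.
rewrite -iterSr iterS; set x := iter k f y0 => fx.
have Bx : B x by apply: iter_ball.
exists x => //; apply/seteqP; split=> [z [/= gz Bz]|z zx].
  have fz : ball2 (radius n) y (f z) by rewrite -gE.
  rewrite /ball2 /= -(iter_isometry 1) //=.
  by apply: (norm2_dist_le fz); rewrite norm2_distC.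
have Bz : B z by apply: norm2_dist_le (le_trans zx (radius_le n)) Bx.
split=> //=; rewrite gE //; apply: norm2_dist_le fx.
by have := iter_isometry 1 Bz Bx => /= ->.
Qed.

Let mrB : {measure set borelQ2 -> \bar R} := mrestr m mB.

(** By [preim_ball], the preimage in [B] of a small ball is a ball of the same radius, so the
    restriction of [m] to [B] and its image under [g] agree on small balls. *)
Let preserves (A : set borelQ2) : measurable A -> m ((g @^-1` A) `&` B) = m (A `&` B).
Proof.
pose m1 : {measure set borelQ2 -> \bar R} := pushforward mrB (g : borelQ2 -> borelQ2).
move=> mA; change (m1 measurable_g A = mrB A).
apply: (@measure_ball2_ext R _ _ rho y0) => //.
- change (m (g @^-1` B `&` B) < +oo)%E.
  rewrite (_ : g @^-1` B `&` B = B); first by rewrite mball // ltry.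
  by apply/seteqP; split=> [x []//|x Bx]; split=> //; apply/gB.
- change (m (g @^-1` (~` B) `&` B) = 0%E).
  rewrite (_ : g @^-1` (~` B) `&` B = set0) ?measure0 //.
  by apply/seteqP; split=> // x [nBx Bx]; apply: nBx; apply/gB.
- by change (m (~` B `&` B) = 0%E); rewrite setICl measure0.
- move=> n y By.
  change (m (g @^-1` ball2 (radius n) y `&` B) = m (ball2 (radius n) y `&` B)).
  have [x Bx ->] := preim_ball n By; rewrite setIidl ?mball //.
  by rewrite -(ball2_eq By); apply: subset_ball2.
Qed.

Section Invariant.
Variable V : set borelQ2.
Hypothesis mV : measurable V.
Hypothesis VB : V `<=` B.
Hypothesis fV : f @` V `<=` V.

Let mVball n x : measurable (V `&` ball2 (radius n) x : set borelQ2).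
Proof. by apply: measurableI => //; apply: measurable_ball2. Qed.

(** Invariance of [V] and the isometry put the left-hand set inside the preimage under [g] of the
    right-hand one. *)
Let mass_f n x : B x ->
  (m (V `&` ball2 (radius n) x) <= m (V `&` ball2 (radius n) (f x)))%E.
Proof.
move=> Bx; rewrite -[X in (_ <= X)%E](_ : m ((V `&` ball2 (radius n) (f x)) `&` B) = _).
  rewrite -preserves // le_measure ?inE //.
    by apply: measurableI => //; apply: measurable_preim.
  move=> y [Vy xy]; have By := VB Vy; split=> //=; rewrite gE //; split.
    by apply: fV; exists y.
  by rewrite /ball2 /=; have /= -> := iter_isometry 1 By Bx.
by congr (m _); apply: setIidl => y [/VB].
Qed.

(** [mass_f] is iterated along an orbit from one ball into the other, in both directions. *)
Let mass_const n x y : B x -> B y ->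
  m (V `&` ball2 (radius n) x) = m (V `&` ball2 (radius n) y).
Proof.
have le z t : B z -> B t ->
    (m (V `&` ball2 (radius n) z) <= m (V `&` ball2 (radius n) t))%E.
  move=> Bz Bt; have [k /ball2_eq <-] := orbit_dense n Bz Bt.
  elim: k => //= k IHk; apply: le_trans IHk _; apply: mass_f.
  exact: iter_ball.
by move=> Bx By; apply/eqP; rewrite eq_le !le.
Qed.

(** The ball splits into two halves, around [x] and around its 2^n-th iterate at distance
    [radius n]; [mass_const] gives them equal mass. *)
Let mass_half n x : B x ->
  m (V `&` ball2 (radius n) x) = (2%:E * m (V `&` ball2 (radius n.+1) x))%E.
Proof.
move=> Bx; have move_x := iter_pow2_move n Bx; set y := iter _ _ _ in move_x.
have By : B y by apply: iter_ball.
have rS : radius n.+1 < radius n by rewrite radiusS ltr_pdivrMr // ltr_pMr // ltr1n.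
have -> : V `&` ball2 (radius n) x
    = (V `&` ball2 (radius n.+1) x) `|` (V `&` ball2 (radius n.+1) y).
  rewrite -setIUr; congr (V `&` _); apply/seteqP; split=> [z zx|z [zx|zy]].
  - have [lt|ge] := ltP (N (z - x)) (radius n).
      by left; rewrite /ball2 /= radiusS; apply: norm2_lt_half.
    have Nzx : N (z - x) = radius n by apply/eqP; rewrite eq_le ge andbT.
    right; rewrite /ball2 /=; have -> : z - y = (z - x) - (y - x).
      by rewrite opprB subrKA.
    by rewrite radiusS -Nzx; apply: norm2_halve; rewrite Nzx move_x.
  - exact: subset_ball2 (ltW rS) _ zx.
  - apply: norm2_dist_le (subset_ball2 (ltW rS) zy) _.
    by rewrite /= move_x.
rewrite measureU //.
  by rewrite mule_natl mule2n; congr (_ + _)%E; apply: mass_const.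
apply/seteqP; split=> // z [[_ zx] [_ zy]].
have : N (y - x) <= radius n.+1.
  by apply: norm2_dist_le (zx); rewrite norm2_distC.
by rewrite move_x leNgt rS.
Qed.

Let m_fin_num (A : set borelQ2) : measurable A -> A `<=` B -> m A \is a fin_num.
Proof.
move=> mA AB; rewrite ge0_fin_numE //; apply: le_lt_trans (ltry rho).
by rewrite -(mball y0 vrho) le_measure ?inE.
Qed.

(** The mass of [V] in a ball is proportional to the radius, cross-multiplied to avoid division in
    the extended reals. *)
Let mass_ball n x : B x ->
  (rho%:E * m (V `&` ball2 (radius n) x))%E = (m V * (radius n)%:E)%E.
Proof.
move=> Bx; elim: n => [|n IHn].
  rewrite /radius expr0 divr1 (ball2_eq Bx) muleC; congr (m _ * _)%E.
  exact: setIidl.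
move: IHn; rewrite mass_half //.
have := m_fin_num (mVball n.+1 x) (fun z Vz => VB Vz.1); have := m_fin_num mV VB.
case: (m V) => // a _; case: (m _) => // b _; rewrite -!EFinM => -[e].
by congr (_%:E); rewrite radiusS; lra.
Qed.

Lemma invariant_ball_measure : m V = 0%E \/ m V = rho%:E.
Proof.
have mVfin := m_fin_num mV VB.
(* The scalars are chosen so that [mass_ball] is exactly the agreement of [m1] and [m2] on small
   balls; evaluation at [V] then gives a quadratic equation for its mass. *)
pose c := NngNum (ltW rho0); pose d := NngNum (fine_ge0 (measure_ge0 m V)).
pose m1 : {measure set borelQ2 -> \bar R} := mscale c (mrestr m mV).
pose m2 : {measure set borelQ2 -> \bar R} := mscale d mrB.
have : m1 V = m2 V.
  apply: (@measure_ball2_ext R _ _ rho y0) => //.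
  - change (rho%:E * m (B `&` V) < +oo)%E; rewrite setIidr //.
    by rewrite -(fineK mVfin) -EFinM ltry.
  - change (rho%:E * m (~` B `&` V) = 0)%E.
    suff -> : ~` B `&` V = set0 by rewrite measure0 mule0.
    by apply/seteqP; split=> // z [nBz /VB].
  - change ((fine (m V))%:E * m (~` B `&` B) = 0)%E.
    by rewrite setICl measure0 mule0.
  - move=> n y By; change (rho%:E * m (ball2 (radius n) y `&` V)
      = (fine (m V))%:E * m (ball2 (radius n) y `&` B))%E.
    rewrite fineK // setIC mass_ball // setIidl ?mball //.
    by rewrite -(ball2_eq By); apply: subset_ball2.
change (rho%:E * m (V `&` V) = (fine (m V))%:E * m (V `&` B) ->
  m V = 0 \/ m V = rho%:E)%E.
rewrite setIid setIidl // fineK //; move: mVfin; case: (m V) => // a _.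
rewrite -!EFinM => -[] /eqP; rewrite -subr_eq0 -mulrBl mulf_eq0 subr_eq0.
by case/orP => /eqP ->; [right|left].
Qed.

End Invariant.
End ErgodicOnBall.

Lemma ler_div_pow2 (R : realFieldType) (r : R) i j :
  0 < r -> (i <= j)%N -> r / 2 ^+ j <= r / 2 ^+ i.
Proof.
move=> r0 ij; rewrite ler_pM2l // lef_pV2 ?posrE ?exprn_gt0 //.
by rewrite ler_eXn2l // ltr1n.
Qed.

(** * Algebraic identities for the rational map *)

Section FieldIdentities.
Variable F : fieldType.
Implicit Types a b c x y : F.
Local Notation h a b c x := ((x ^+ 2 + a * x + b) / (x + c)).

Lemma ratfun_sub_fixpoint a b c x : c - a != 0 -> x + c != 0 ->
  h a b c x - b / (c - a) = (x - b / (c - a)) * (x + a) / (x + c).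
Proof. by move=> ca xc; field; rewrite xc ca. Qed.

Lemma ratfun_sub_id a b c x : c - a != 0 -> x + c != 0 ->
  h a b c x - x = (x - b / (c - a)) * (a - c) / (x + c).
Proof. by move=> ca xc; field; rewrite xc ca. Qed.

(** The norm of the factor multiplying [x - y] is the contraction ratio of f minus the identity. *)
Lemma ratfun_sub a b c x y : c - a != 0 -> x + c != 0 -> y + c != 0 ->
  h a b c x - h a b c y - (x - y)
    = (x - y) * ((b / (c - a) + c) * (a - c) / ((x + c) * (y + c))).
Proof. by move=> ca xc yc; field; rewrite xc yc ca. Qed.

(** Two uses of [ratfun_sub_fixpoint], then (x + a)(y + a) - (x + c)(y + c) = (a - c)(x + y + a +
    c). *)
Lemma ratfun_twice_sub_id a b c x y : c - a != 0 -> x + c != 0 ->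
  y = h a b c x -> y + c != 0 ->
  h a b c y - x = (x - b / (c - a)) * ((a - c) * ((x + y) + (a + c)))
                    / ((x + c) * (y + c)).
Proof.
move=> ca xc yE yc; set x0 := b / (c - a).
have ex : y - x0 = (x - x0) * (x + a) / (x + c) by rewrite yE ratfun_sub_fixpoint.
have ey : h a b c y - x0 = (y - x0) * (y + a) / (y + c).
  exact: ratfun_sub_fixpoint.
by rewrite -[LHS](subrKA x0) ey ex; field; rewrite yc xc.
Qed.

End FieldIdentities.

(** * Norm estimates for the map on an invariant sphere *)

Section Sphere.
Variables (R : realType) (a b c : Q2) (r q : R).
Local Notation N := (norm2 R).
Local Notation x0 := (b / (c - a)).
Local Notation f := (ratfun a b c).
Local Notation S := (sphere2 r x0).
Hypothesis ac : a != c.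
Hypothesis q0 : 0 < q.
(** A single [q] covers both situations: q = r when r exceeds alpha and beta, and q = beta when
    alpha = beta > r. *)
Hypothesis Na : forall x, S x -> N (x + a) = q.
Hypothesis Nc : forall x, S x -> N (x + c) = q.

Let ca0 : c - a != 0. Proof. by rewrite subr_eq0 eq_sym. Qed.

Let xc0 x : S x -> x + c != 0.
Proof. by move=> Sx; rewrite -(norm2_eq0 R) Nc // gt_eqF. Qed.

Lemma ratfun_sphere x : S x -> S (f x).
Proof.
move=> Sx; rewrite /sphere2 /= /ratfun ratfun_sub_fixpoint ?xc0 //.
by rewrite !norm2M norm2V Na // Nc // mulfK ?gt_eqF.
Qed.

Lemma norm2_ratfun_sub_id x : S x -> N (f x - x) = r * N (a - c) / q.
Proof.
move=> Sx; rewrite /ratfun ratfun_sub_id ?xc0 //.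
by rewrite !norm2M norm2V Nc // Sx.
Qed.

Lemma norm2_ratfun_sub x y : S x -> S y ->
  N (f x - f y - (x - y)) = N (x - y) * (N (x0 + c) * N (a - c) / q ^+ 2).
Proof.
move=> Sx Sy; rewrite /ratfun ratfun_sub ?xc0 //.
by rewrite !norm2M norm2V norm2M (Nc Sx) (Nc Sy) expr2.
Qed.

Lemma norm2_ratfun_twice_sub_id x : S x ->
  N (f (f x) - x) = r * (N (a - c) * N ((x + f x) + (a + c))) / q ^+ 2.
Proof.
move=> Sx; have Sy := ratfun_sphere Sx; set y := f x in Sy *.
rewrite {1}/ratfun (@ratfun_twice_sub_id _ _ _ _ x) ?xc0 //.
by rewrite norm2M norm2V !norm2M (Nc Sx) (Nc Sy) Sx expr2.
Qed.

Lemma ratfun_nonexpansive x y : N (x0 + c) <= q -> N (a - c) <= q ->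
  S x -> S y -> N (f x - f y) <= N (x - y).
Proof.
move=> bq acq Sx Sy; rewrite -[f x - f y](subrK (x - y)).
apply: norm2_addr_le => //; rewrite norm2_ratfun_sub //.
rewrite ler_piMr ?norm2_ge0 // ler_pdivrMr ?exprn_gt0 // mul1r expr2.
by rewrite ler_pM ?norm2_ge0.
Qed.

End Sphere.

(** * Criteria for ergodicity and non-ergodicity on a sphere *)

Section Main.
Variables (R : realType) (m : {measure set borelQ2 -> \bar R}).
Local Notation N := (norm2 R).
Hypothesis mball : forall s rho, norm2_value rho -> m (ball2 rho s) = rho%:E.

(** The sphere has mass r / 2, so the normalized measure of [V] lies between 1/4 and 1/2. *)
Lemma sphere_not_ergodic (f : Q2 -> Q2) (r : R) (x0 y : Q2) (V : set borelQ2) :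
  norm2_value r -> measurable V -> V `<=` sphere2 r x0 -> f @` V `<=` V ->
  sphere2 r x0 y -> ball2 (r / 2 ^+ 3) y `<=` V -> (m V <= (r / 2 ^+ 2)%:E)%E ->
  ~ ergodic (sphere2 r x0) f (sphere_measure m r x0).
Proof.
move=> vr mV VS fV Sy yV Vle erg; have r0 := norm2_value_gt0 vr.
have mS : m (sphere2 r x0) = (r / 2)%:E.
  by rewrite (sphere2_ball vr Sy) mball //; apply: norm2_value_half.
have Vge : ((r / 2 ^+ 3)%:E <= m V)%E.
  rewrite -(mball y (norm2_value_divX 3 vr)) le_measure ?inE //.
  by apply: measurable_ball2; rewrite divr_gt0 ?exprn_gt0.
have := erg V mV VS fV; rewrite /sphere_measure setIidl // mS /=.
case: (m V) Vge Vle => // v; rewrite !lee_fin -!EFinM => v1 v2.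
have v0 : 0 < v by apply: lt_le_trans v1; rewrite divr_gt0 ?exprn_gt0.
have r2 : r / 2 != 0 by rewrite gt_eqF // divr_gt0.
have r4 : r / 2 ^+ 2 < r / 2.
  by rewrite expr2 invfM mulrA ltr_pdivrMr // ltr_pMr ?ltr1n // divr_gt0.
case=> -[/(canRL (divfK r2)) vE]; move: v0 v2; rewrite vE.
  by rewrite mul0r ltxx.
by rewrite mul1r leNgt r4.
Qed.

(** A ball of radius r / 4 absorbs displacements of that size, so it is invariant; it fills half of
    the sphere. *)
Lemma not_ergodic_of_move_le (f : Q2 -> Q2) (r : R) (x0 : Q2) :
  norm2_value r -> (forall x, sphere2 r x0 x -> N (f x - x) <= r / 2 ^+ 2) ->
  ~ ergodic (sphere2 r x0) f (sphere_measure m r x0).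
Proof.
move=> vr fle; have r0 := norm2_value_gt0 vr.
have [t Nt] := norm2_value_ex vr.
have Sy : sphere2 r x0 (x0 + t) by rewrite /sphere2 /= addrC addKr.
set y := x0 + t in Sy.
have r4 : 0 < r / 2 ^+ 2 by rewrite divr_gt0 ?exprn_gt0.
have VS : ball2 (r / 2 ^+ 2) y `<=` sphere2 r x0.
  rewrite (sphere2_ball vr Sy); apply: subset_ball2.
  exact: (@ler_div_pow2 _ _ 1).
apply: (sphere_not_ergodic vr _ VS _ Sy).
- exact: measurable_ball2.
- by move=> _ [z yz <-]; apply: norm2_dist_le (yz); apply: fle; apply: VS.
- apply: subset_ball2.
  exact: ler_div_pow2.
- by rewrite mball //; apply: norm2_value_divX.
Qed.

(** [f] maps the ball around [y] into the ball around [f y], and the latter back into the former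
    because [f (f y)] is within r / 8 of [y]. *)
Lemma not_ergodic_of_twice_move_le (f : Q2 -> Q2) (r : R) (x0 : Q2) :
  norm2_value r -> (forall x, sphere2 r x0 x -> sphere2 r x0 (f x)) ->
  (forall x y, sphere2 r x0 x -> sphere2 r x0 y -> N (f x - f y) <= N (x - y)) ->
  (forall x, sphere2 r x0 x -> N (f (f x) - x) <= r / 2 ^+ 3) ->
  ~ ergodic (sphere2 r x0) f (sphere_measure m r x0).
Proof.
move=> vr fS fne fle; have r0 := norm2_value_gt0 vr.
have [t Nt] := norm2_value_ex vr.
have Sy : sphere2 r x0 (x0 + t) by rewrite /sphere2 /= addrC addKr.
set y := x0 + t in Sy.
have r8 : 0 < r / 2 ^+ 3 by rewrite divr_gt0 ?exprn_gt0.
have ballS z : sphere2 r x0 z -> ball2 (r / 2 ^+ 3) z `<=` sphere2 r x0.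
  move=> Sz; rewrite (sphere2_ball vr Sz); apply: subset_ball2.
  exact: (@ler_div_pow2 _ _ 1).
have mball8 z : measurable (ball2 (r / 2 ^+ 3) z : set borelQ2).
  exact: measurable_ball2.
apply: (@sphere_not_ergodic _ _ _ y
  (ball2 (r / 2 ^+ 3) y `|` ball2 (r / 2 ^+ 3) (f y))) => //.
- exact: measurableU.
- by move=> z [|]; apply: ballS => //; apply: fS.
- move=> _ [z [yz|yz] <-]; [right|left].
    by apply: le_trans (fne _ _ _ _) (yz) => //; apply: ballS yz.
  apply: norm2_dist_le (fle _ Sy).
  by apply: le_trans (fne _ _ _ _) (yz); [apply: ballS yz|]; exact: fS.
(* The two balls may coincide, hence subadditivity. *)
- have le2 : (m (ball2 (r / 2 ^+ 3) y) + m (ball2 (r / 2 ^+ 3) (f y))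
      <= (r / 2 ^+ 2)%:E)%E.
    rewrite !mball; try exact: norm2_value_divX.
    by rewrite -EFinD lee_fin exprSr invfM mulrA -splitr.
  by apply: le_trans le2; apply: measureU2.
Qed.

Lemma ergodic_of_almost_translation (f : Q2 -> Q2) (r : R) (x0 : Q2) :
  norm2_value r -> (forall x, sphere2 r x0 x -> sphere2 r x0 (f x)) ->
  (forall x, sphere2 r x0 x -> N (f x - x) = r / 2) ->
  (forall x y, sphere2 r x0 x -> sphere2 r x0 y ->
     N (f x - f y - (x - y)) <= N (x - y) / 4) ->
  ergodic (sphere2 r x0) f (sphere_measure m r x0).
Proof.
move=> vr; have vr2 := norm2_value_half vr; have r2 := norm2_value_gt0 vr2.
have [t Nt] := norm2_value_ex vr.
have Sy : sphere2 r x0 (x0 + t) by rewrite /sphere2 /= addrC addKr.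
rewrite (sphere2_ball vr Sy) => fB f_move f_almost V mV VB fV.
rewrite /sphere_measure (sphere2_ball vr Sy) setIidl // mball //=.
case: (invariant_ball_measure mball vr2 fB f_move f_almost mV VB fV) => ->.
  by left; rewrite mul0e.
by right; rewrite -EFinM divff // gt_eqF.
Qed.

End Main.

(* One of [A - B], [A + B] has norm at most |B| / 4, and both at most |B| / 2. *)
Lemma norm2_sub_mul_add (R : realType) (A B : Q2) : norm2 R A = norm2 R B ->
  norm2 R (A - B) * norm2 R (A + B) <= norm2 R B ^+ 2 / 2 ^+ 3.
Proof.
move=> AB; have d2 : norm2 R (A - B) <= norm2 R B / 2 by rewrite -AB; apply: norm2_halve.
have s2 : norm2 R (A + B) <= norm2 R B / 2.
  by rewrite -AB -[B]opprK; apply: norm2_halve; rewrite norm2N.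
have [B0|B0] := eqVneq B 0.
  have A0 : A = 0 by apply/eqP; rewrite -(norm2_eq0 R) AB norm2_eq0 B0.
  by rewrite A0 B0 subrr norm2_0 mul0r expr2 !mul0r.
have vB := norm2_is_value R B0; have vB2 := norm2_value_half vB.
have Bgt0 := norm2_value_gt0 vB.
have [dlt|dge] := ltP (norm2 R (A - B)) (norm2 R B / 2).
  have d4 := norm2_lt_half vB2 dlt.
  apply: le_trans (ler_pM (norm2_ge0 _ _) (norm2_ge0 _ _) d4 s2) _.
  by rewrite le_eqVlt; apply/orP; left; apply/eqP; field.
suff s4 : norm2 R (A + B) <= norm2 R B / 2 / 2.
  apply: le_trans (ler_pM (norm2_ge0 _ _) (norm2_ge0 _ _) d2 s4) _.
  by rewrite le_eqVlt; apply/orP; left; apply/eqP; field.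
have dE : norm2 R (A - B) = norm2 R B / 2 by apply/eqP; rewrite eq_le d2.
(* Here [2 * B] and [B - A] both have norm |B| / 2, so their difference is halved once more. *)
have -> : A + B = 2 * B - (B - A).
  by rewrite mulr_natl mulr2n opprB addrACA subrr addr0 addrC.
have N2B : norm2 R (2 * B) = norm2 R B / 2 by rewrite norm2M norm2_2 mulrC.
by rewrite -N2B; apply: norm2_halve; rewrite N2B norm2_distC dE.
Qed.

(** * Case analysis on alpha, beta and r *)

Theorem theorem6 (R : realType) (a b c : Q2)
    (mubar : {measure set borelQ2 -> \bar R}) (r : R) :
  a != c -> c ^+ 2 - a * c + b != 0 ->
  is_haar2 mubar ->
  let x0 := b / (c - a) in
  let alpha := norm2 R (x0 + a) in
  let beta := norm2 R (x0 + c) in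
  radii alpha beta r -> norm2_value r ->
  ergodic (sphere2 r x0) (ratfun a b c) (sphere_measure mubar r x0) <->
  (alpha != beta /\ r = 2 * Num.max alpha beta).
Proof.
move=> ac xc [_ mball] x0 alpha beta rI vr; have r0 := norm2_value_gt0 vr.
have ca : c - a != 0 by rewrite subr_eq0 eq_sym.
have x0c : x0 + c != 0.
  apply: contra xc => /eqP xc; rewrite -[X in X == 0](_ : (x0 + c) * (c - a) = _).
    by rewrite xc mul0r.
  by rewrite /x0 mulrDl divfK // expr2 mulrBr [c * a]mulrC addrC.
have vbeta : norm2_value beta by apply: norm2_is_value.
have beta0 := norm2_value_gt0 vbeta.
have acE : a - c = (x0 + a) - (x0 + c) by rewrite opprD addrACA subrr add0r.
have shift x e : x + e = (x - x0) + (x0 + e) by rewrite addrA subrK.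
have far e x : norm2 R (x0 + e) < r -> sphere2 r x0 x -> norm2 R (x + e) = r.
  by move=> er Sx; rewrite shift addrC norm2_addl_lt Sx.
(* Outside both critical circles, [f x - x] has norm |a - c| on the sphere. *)
have outer_not_ergodic : alpha < r -> beta < r -> norm2 R (a - c) <= r / 2 ^+ 2 ->
    ~ ergodic (sphere2 r x0) (ratfun a b c) (sphere_measure mubar r x0).
  move=> ar br acr; apply: (not_ergodic_of_move_le mball vr) => x Sx.
  rewrite (norm2_ratfun_sub_id ac r0 _ Sx) => [|y]; last exact: far.
  by rewrite mulrAC divff ?gt_eqF // mul1r.
move: rI; rewrite /radii; have [ab|ab] := eqVneq alpha beta => -[_ rI].
  split=> [erg|[]//]; exfalso; move: erg.
  have ac2 : norm2 R (a - c) <= beta / 2 by rewrite acE -ab; apply: norm2_halve.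
  have [rb|br|rb] := ltgtP r beta; last by rewrite rb eqxx in rI.
    (* Case r < alpha = beta: the constant terms [x0 + a] and [x0 + c] dominate on the sphere. *)
    have Na x : sphere2 r x0 x -> norm2 R (x + a) = beta.
      by move=> Sx; rewrite shift norm2_addl_lt // Sx -/alpha ab.
    have Nc x : sphere2 r x0 x -> norm2 R (x + c) = beta.
      by move=> Sx; rewrite shift norm2_addl_lt // Sx.
    have fS := ratfun_sphere ac beta0 Na Nc.
    apply: (not_ergodic_of_twice_move_le mball vr fS) => [x y|x Sx].
      apply: (ratfun_nonexpansive ac beta0) => //.
      by apply: le_trans ac2 _; rewrite ler_pdivrMr // ler_peMr ?ler1n // ltW.
    rewrite (norm2_ratfun_twice_sub_id ac beta0 Na Nc Sx); set y := ratfun a b c x.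
    have Sy : sphere2 r x0 y by exact: fS.
    rewrite ler_pdivrMr ?exprn_gt0 // -[leRHS]mulrA ler_pM2l // -norm2M.
    (* The sum is split into a part of norm at most r / 2 and A + B. Multiplied by A - B, the first
       is bounded using r <= beta / 2, the second by [norm2_sub_mul_add]. *)
    have -> : x + y + (a + c) = ((x - x0) + (y - x0)) + ((x0 + a) + (x0 + c)).
      by rewrite addrACA (shift x a) (shift y c) addrACA.
    have rb2 := norm2_value_lt vr vbeta rb.
    have xy2 : norm2 R ((x - x0) + (y - x0)) <= r / 2.
      by rewrite -Sx -[y - x0]opprK; apply: norm2_halve; rewrite norm2N Sx Sy.
    rewrite mulrDr [_^-1 * _]mulrC; apply: norm2_addr_le; rewrite norm2M.
      apply: le_trans (ler_pM (norm2_ge0 _ _) (norm2_ge0 _ _) ac2 xy2) _.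
      nra.
    by rewrite acE; apply: norm2_sub_mul_add.
  apply: outer_not_ergodic; rewrite ?ab //.
  (* Case alpha = beta < r: |a - c| <= beta / 2 and beta <= r / 2. *)
  have := norm2_value_lt vbeta vr br; lra.
have Nac : norm2 R (a - c) = Num.max alpha beta.
  rewrite acE; case: (ltgtP alpha beta) ab => // [lt|gt] _.
    by rewrite norm2_addl_lt ?norm2N.
  by rewrite [_ - _]addrC norm2_addl_lt ?norm2N.
have [ar br] : alpha < r /\ beta < r by move: rI; rewrite gt_max => /andP.
split=> [erg|[_ rE]].
  split=> //; apply/eqP; apply: contrapT => /negP rne; apply: outer_not_ergodic erg => //.
  have vr2 := norm2_value_half vr.
  (* Since r exceeds the maximum but is not twice it, |a - c| is a norm value below r / 2, hence at
     most r / 4. *)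
  have ltmax : norm2 R (a - c) < r / 2.
    rewrite lt_neqAle norm2_lt_half // ?Nac // andbT.
    by apply: contra rne => /eqP ->; rewrite mulrC divfK ?pnatr_eq0.
  by rewrite expr2 invfM mulrA; apply: norm2_lt_half.
have Na x : sphere2 r x0 x -> norm2 R (x + a) = r by exact: far.
have Nc x : sphere2 r x0 x -> norm2 R (x + c) = r by exact: far.
have Nac2 : norm2 R (a - c) = r / 2 by rewrite Nac rE mulrC mulKf ?pnatr_eq0.
apply: (ergodic_of_almost_translation mball vr).
- exact: (ratfun_sphere ac r0 Na Nc).
- by move=> x Sx; rewrite (norm2_ratfun_sub_id ac r0 Nc) // mulrAC divff ?gt_eqF // mul1r.
- move=> x y Sx Sy; rewrite (norm2_ratfun_sub ac r0 Nc) //.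
  apply: ler_wpM2l; first exact: norm2_ge0.
  rewrite Nac2 ler_pdivrMr ?exprn_gt0 //.
  (* The contraction ratio is beta (r / 2) / r^2, which is at most 1/4 because beta <= r / 2. *)
  rewrite -/x0 -/beta; have := norm2_value_lt vbeta vr br; nra.
Qed.
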